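(* For any positive integer $n$ the group of units $H(\mathbb{I})$ of the semigroup $\mathscr{IPF}(\mathbb{N}^n)$ is isomorphic to the symmetric group $\mathscr{S}_n$. Moreover, every element of $H(\mathbb{I})$ is induced by a permutation of the set $\{1,\ldots,n\}$, i.e. it acts on $\mathbb{N}^n$ by permuting coordinates.
   Context: $\mathbb{N}$ is the set of positive integers; $(\mathbb{N}^n,\leqslant)$ carries the product (coordinatewise) order; ${\uparrow}\mathbf{x}=\{\mathbf{y}\in\mathbb{N}^n:\mathbf{x}\leqslant\mathbf{y}\}$ is the principal filter generated by $\mathbf{x}$. $\mathscr{IPF}(\mathbb{N}^n)$ is the semigroup of all order isomorphisms between principal filters of $(\mathbb{N}^n,\leqslant)$, with composition of partial maps (maps written on the right, composed left to right, $z(\alpha\beta)=(z\alpha)\beta$ wherever defined). $\mathbb{I}$ is the identity map of $\mathbb{N}^n$, which is the identity element of $\mathscr{IPF}(\mathbb{N}^n)$, and $H(\mathbb{I})$ is its group of units. $\mathscr{S}_n$ is the group of all permutations of an $n$-element set. A permutation $\sigma$ of $\{1,\ldots,n\}$ induces the map $(x_1,\ldots,x_n)\mapsto(x_{(1)\sigma^{-1}},\ldots,x_{(n)\sigma^{-1}})$ of $\mathbb{N}^n$. *)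

(* Defs.v *)
From HB Require Import structures.
From mathcomp Require Import all_boot all_order all_fingroup.
From mathcomp Require Import boolp.

Set Implicit Arguments.
Unset Strict Implicit.
Unset Printing Implicit Defensive.

Import Order.TTheory.
Local Open Scope order_scope.

Record posnat := PosNat { posnat_val :> nat; _ : (0 < posnat_val)%N }.

HB.instance Definition _ := [isSub for posnat_val].
HB.instance Definition _ := [Choice of posnat by <:].
HB.instance Definition _ :=
  [SubChoice_isSubOrder of posnat by <: with Order.NatOrder.nat_display].

Definition posnat1 : posnat := @PosNat 1 isT.

Lemma posnat1_le (m : posnat) : posnat1 <= m.
Proof. by case: m. Qed.

HB.instance Definition _ := Order.hasBottom.Build _ posnat posnat1_le.

(* The order of [n.-tupleprod] is coordinatewise: see [leEtprod]. *)
Notation posnats n := (n.-tupleprod posnat).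

Section IPF.
Context {d : Order.disp_t}.

(* A partial self-map of T is a function T -> option T, with value None
   outside its domain. *)
Definition pdom (T : Type) (f : T -> option T) (u : T) : Prop :=
  exists v, f u = Some v.

Definition pran (T : Type) (f : T -> option T) (v : T) : Prop :=
  exists u, f u = Some v.

Definition principal_filter (T : porderType d) (x u : T) : Prop := x <= u.

(* Injectivity of f follows from the last clause by antisymmetry. *)
Definition filter_iso (T : porderType d) (f : T -> option T) : Prop :=
  exists x y : T,
    [/\ forall u, pdom f u <-> principal_filter x u,
        forall v, pran f v <-> principal_filter y v
      & forall u u' v v', f u = Some v -> f u' = Some v' ->
          u <= u' <-> v <= v'].

Record ipf (T : latticeType d) : Type :=
  Ipf { ipf_map :> T -> option T; ipf_mapP : filter_iso ipf_map }.

HB.instance Definition _ (T : latticeType d) := gen_eqMixin (ipf T).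
HB.instance Definition _ (T : latticeType d) := gen_choiceMixin (ipf T).

Variable T : latticeType d.
Implicit Types f g h : ipf T.

Lemma ipf_ext f g : (forall u, f u = g u) -> f = g.
Proof.
case: f g => [f fP] [g gP] /= /funext fg.
by case: _ / fg in gP *; rewrite (Prop_irrelevance fP gP).
Qed.

(* Left-to-right composition: first f, then g. *)
Definition pcomp (f g : T -> option T) (u : T) : option T := obind g (f u).

(* The composite is defined on the f-preimage of the filter generated by the
   join of the generators of the range of f and of the domain of g. *)
Lemma filter_iso_comp f g : filter_iso (pcomp f g).
Proof.
case: f g => [f [x [y [fd fr fle]]]] [g [z [t [gd gr gle]]]] /=.
rewrite /principal_filter in fd fr gd gr.
have /fr[p fp] : y <= Order.join y z by exact: leUl.
have /gd[q gq] : z <= Order.join y z by exact: leUr.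
exists p, q; split.
- move=> u; split=> [[w]|].
  + rewrite /pcomp; case fu: (f u) => [v|//] /= gv.
    apply/(fle _ _ _ _ fp fu); rewrite leUx.
    by apply/andP; split; [apply/fr; exists u|apply/gd; exists w].
  + move=> pu; have xp : x <= p by apply/fd; exists (Order.join y z).
    have /fd[v fu] : x <= u by exact: le_trans pu.
    have /gd[w gv] : z <= v.
      by apply: le_trans (leUr _ y) _; apply/(fle _ _ _ _ fp fu).
    by exists w; rewrite /pcomp fu.
- move=> w; split=> [[u]|].
  + rewrite /pcomp; case fu: (f u) => [v|//] /= gv.
    apply/(gle _ _ _ _ gq gv); rewrite leUx.
    by apply/andP; split; [apply/fr; exists u|apply/gd; exists w].
  + move=> qw; have tq : t <= q by apply/gr; exists (Order.join y z).
    have /gr[v gv] : t <= w by exact: le_trans qw.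
    have /fr[u fu] : y <= v.
      by apply: le_trans (leUl _ z) _; apply/(gle _ _ _ _ gq gv).
    by exists u; rewrite /pcomp fu.
- move=> u u' w w'; rewrite /pcomp.
  case fu: (f u) => [v|//] /= gv; case fu': (f u') => [v'|//] /= gv'.
  by rewrite (fle _ _ _ _ fu fu') (gle _ _ _ _ gv gv').
Qed.

Definition ipf_mul f g : ipf T := Ipf (filter_iso_comp f g).

Lemma ipf_mulA : associative ipf_mul.
Proof. by move=> f g h; apply: ipf_ext => u /=; rewrite /pcomp /=; case: (f u). Qed.

End IPF.

(* The identity map belongs to the semigroup when T is itself the principal
   filter generated by a least element. *)
Section IPFMonoid.
Context {d : Order.disp_t}.
Variable T : bLatticeType d.

Lemma filter_iso_id : filter_iso (@Some T).
Proof.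
exists \bot, \bot; rewrite /principal_filter; split.
- by move=> u; rewrite le0x; split=> // _; exists u.
- by move=> v; rewrite le0x; split=> // _; exists v.
- by move=> u u' v v' [->] [->].
Qed.

Definition ipf_one : ipf T := Ipf filter_iso_id.

Lemma ipf_mul1 : left_id ipf_one (@ipf_mul d T).
Proof. by move=> f; apply: ipf_ext. Qed.

Lemma ipf_mulr1 : right_id ipf_one (@ipf_mul d T).
Proof. by move=> f; apply: ipf_ext => u; rewrite /= /pcomp; case: (f u). Qed.

HB.instance Definition _ :=
  isMonoid.Build (ipf T) (@ipf_mulA d T) ipf_mul1 ipf_mulr1.

End IPFMonoid.

Section Units.
Variable M : monoidType.
Local Open Scope group_scope.

Definition is_unit : {pred M} :=
  [pred x : M | `[< exists y, x * y = 1 /\ y * x = 1 >]].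

Record units := Unit { unit_val :> M; _ : unit_val \in is_unit }.

HB.instance Definition _ := [isSub for unit_val].
HB.instance Definition _ := [Choice of units by <:].

Lemma is_unit_closed : monoid_closed is_unit.
Proof.
split=> [|x y /asboolP[x' [xx' x'x]] /asboolP[y' [yy' y'y]]].
  by apply/asboolP; exists 1; rewrite mulg1.
apply/asboolP; exists (y' * x'); split.
  by rewrite mulgA -(mulgA x) yy' mulg1.
by rewrite mulgA -(mulgA y') x'x mulg1.
Qed.

HB.instance Definition _ :=
  SubChoice_isSubMonoid.Build M is_unit units is_unit_closed.

Lemma units_inv_ex (x : units) :
  exists y : units, (x * y == 1) && (y * x == 1).
Proof.
case: x => x xU; have /asboolP[y [xy yx]] := xU.
have yU : y \in is_unit by apply/asboolP; exists x.
by exists (Unit yU); apply/andP; split; apply/eqP/val_inj; rewrite valM val1.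
Qed.

Definition units_inv (x : units) : units := xchoose (units_inv_ex x).

Lemma units_mulVg : left_inverse 1 units_inv *%g.
Proof. by move=> x; have /andP[_ /eqP] := xchooseP (units_inv_ex x). Qed.

Lemma units_mulgV : right_inverse 1 units_inv *%g.
Proof. by move=> x; have /andP[/eqP] := xchooseP (units_inv_ex x). Qed.

HB.instance Definition _ := hasInv.Build units units_inv.
HB.instance Definition _ := Monoid_isGroup.Build units units_mulVg units_mulgV.

End Units.

Definition isomorphic (G H : groupType) : Prop :=
  exists f : {multiplicative G -> H}, bijective f.

Definition permute_coords (n : nat) (s : 'S_n) (x : posnats n) : posnats n :=
  [tuple tnth x ((s^-1)%g i) | i < n].

(* Main.v *)
Require Import Defs.
From mathcomp Require Import all_boot all_order all_fingroup.
From HB Require Import structures.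
From mathcomp Require Import boolp.

(** An order automorphism phi of N^n preserves the rank function
    sum_i (x_i - 1): strict monotonicity gives one inequality by induction along
    a maximal chain below x, and the inverse of phi gives the other.  Hence phi
    permutes the atoms, which are the points with a single coordinate 2 and the
    others 1; let s be the induced permutation of the indices.  A point with a
    single coordinate k at i and the others 1 lies above no atom but the i-th,
    so its image has the same shape at s i, with the same k because of the rank.
    These points detect all coordinates, and therefore phi permutes coordinates
    along s. *)

Set Implicit Arguments.
Unset Strict Implicit.
Unset Printing Implicit Defensive.

Import Order.TTheory.
Local Open Scope order_scope.

(** * Rank function and points with at most one coordinate above 1 *)

Section Height.
Variable n : nat.
Implicit Types (x y : posnats n) (i j : 'I_n) (k : nat).

(** Coordinates start at 1; the shift to 0 makes the rank a plain sum. *)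
Definition height x i : nat := (tnth x i : nat).-1.

Definition of_height (f : 'I_n -> nat) : posnats n :=
  [tuple @PosNat (f i).+1 isT | i < n].

Lemma height_of_height f i : height (of_height f) i = f i.
Proof. by rewrite /height tnth_mktuple. Qed.

Lemma le_height x y :
  reflect (forall i, (height x i <= height y i)%N) (x <= y).
Proof.
rewrite leEtprod; apply: (iffP forallP) => xy i; move: (xy i);
by rewrite -Order.le_val /height leEnat /=; case: (tnth x i) (tnth y i) => [[]//a ?] [[]].
Qed.

Lemma height_inj x y : height x =1 height y -> x = y.
Proof.
by move=> xy; apply/le_anti/andP; split; apply/le_height => i; rewrite xy.
Qed.

Definition weight x : nat := \sum_i height x i.

Lemma weight_of_height f : weight (of_height f) = \sum_i f i.
Proof. by apply: eq_bigr => i _; rewrite height_of_height. Qed.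

Lemma weight_gt0 x : (0 < weight x)%N -> exists i, (0 < height x i)%N.
Proof.
by rewrite lt0n sum_nat_eq0 negb_forall => /existsP[i]; exists i; rewrite lt0n.
Qed.

Lemma weight_lt x y : x < y -> (weight x < weight y)%N.
Proof.
rewrite lt_neqAle => /andP[xny /le_height xy].
have := leqif_sum (fun i (_ : true) => leqif_eq (xy i)).
move=> /ltn_leqif ->; apply: contra xny => /forallP xyE.
by apply/eqP/height_inj => i; apply/eqP/(implyP (xyE i)).
Qed.

Lemma weight_le_homo (phi : posnats n -> posnats n) :
  {homo phi : x y / x < y} -> forall x, (weight x <= weight (phi x))%N.
Proof.
move=> phi_lt x; move: {2}(weight x) (erefl (weight x)) => m.
elim: m x => [|m IHm] x xm; first by rewrite xm.
have [i xi_gt0] : exists i, (0 < height x i)%N by apply: weight_gt0; rewrite xm.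
(* One step below [x]; the truncated subtraction is exact since [height x i] is positive. *)
pose x' := of_height (fun j => height x j - (j == i))%N.
have x'm : weight x' = m.
  apply/eqP; rewrite -eqSS -xm -addn1 weight_of_height; apply/eqP.
  have <- : (\sum_j (j == i) = 1)%N.
    by rewrite (bigD1 i) //= eqxx big1 // => j /negbTE ->.
  rewrite -big_split; apply: eq_bigr => j _ /=.
  by rewrite subnK //; case: eqP => // ->.
have x'x : x' < x.
  rewrite lt_neqAle; apply/andP; split.
    by apply/eqP => x'x; move/eqP: x'm; rewrite x'x xm eqn_leq ltnn.
  by apply/le_height => j; rewrite height_of_height leq_subr.
by rewrite xm -x'm; apply: leq_ltn_trans (IHm _ x'm) _; apply/weight_lt/phi_lt.
Qed.

(** Coordinate [k.+1] at [i] and 1 elsewhere; the points [spike i 1] are the atoms. *)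
Definition spike i k : posnats n := of_height (fun j => (j == i) * k)%N.

Lemma weight_spike i k : weight (spike i k) = k.
Proof.
rewrite weight_of_height (bigD1 i) //= eqxx mul1n big1 ?addn0 //.
by move=> j /negbTE ->.
Qed.

(** Only coordinate [i] constrains, so comparison with spikes reads off single heights. *)
Lemma spike_le i k x : (spike i k <= x) = (k <= height x i)%N.
Proof.
apply/le_height/idP => [/(_ i)|kx j]; first by rewrite height_of_height eqxx mul1n.
by rewrite height_of_height; case: eqP => [->|//]; rewrite mul1n.
Qed.

Lemma eq_spike i x : (forall j, j != i -> height x j = 0%N) -> x = spike i (weight x).
Proof.
move=> x0; apply: height_inj => j; rewrite height_of_height /weight (bigD1 i) //=.
rewrite big1 ?addn0 //; case: eqP => [->|/eqP/x0 //]; by rewrite mul1n.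
Qed.

(** A positive height puts [x] above an atom, and equal weights exclude a strict inequality. *)
Lemma weight1_spike x : weight x = 1%N -> exists i, x = spike i 1.
Proof.
move=> x1.
have [i xi] : exists i, (0 < height x i)%N by apply: weight_gt0; rewrite x1.
exists i; apply/eqP; rewrite eq_sym; apply/negPn/negP => xn.
have : spike i 1 < x by rewrite lt_neqAle xn spike_le.
by move=> /weight_lt; rewrite weight_spike x1.
Qed.

Lemma spike_inj i j : spike i 1 = spike j 1 -> i = j.
Proof.
move=> /(congr1 (fun x => height x i)); rewrite !height_of_height eqxx.
by case: eqP.
Qed.

End Height.

(** * Order automorphisms of N^n *)

Section Automorphism.
Variable n : nat.
Variables phi psi : posnats n -> posnats n.
Hypothesis phiK : cancel phi psi.
Hypothesis psiK : cancel psi phi.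
Hypothesis phi_le : {mono phi : x y / x <= y}.

Lemma automorphism_weight x : weight (phi x) = weight x.
Proof.
have psi_le : {mono psi : x y / x <= y} := can_mono psiK phi_le.
apply/eqP; rewrite eqn_leq; apply/andP; split; last first.
  by apply: weight_le_homo => u v; rewrite (leW_mono phi_le).
(* The same inequality for [psi], at the point [phi x]. *)
rewrite -{2}(phiK x).
by apply: weight_le_homo => u v; rewrite (leW_mono psi_le).
Qed.

Lemma automorphism_permute_coords : exists s, forall x, phi x = permute_coords s x.
Proof.
have atom i : {j | phi (spike i 1) = spike j 1}.
  by apply/cid/weight1_spike; rewrite automorphism_weight weight_spike.
pose t i := sval (atom i).
have phit i : phi (spike i 1) = spike (t i) 1 := svalP (atom i).
have t_inj : injective t.
  by move=> i j tij; apply/spike_inj/(can_inj phiK); rewrite !phit tij.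
pose s := perm t_inj; exists s => x.
have phis i k : phi (spike i k) = spike (s i) k.
  rewrite [LHS](@eq_spike _ (s i)); first by rewrite automorphism_weight weight_spike.
  (* Write [j] as [s i'] with [i' != i]. A positive height at [j] would put the atom
     [phi (spike i' 1)] below [phi (spike i k)], hence [spike i' 1] below [spike i k]. *)
  move=> j; rewrite -(permKV s j) (inj_eq perm_inj) => ji.
  set i' := (s^-1%g j) in ji *; rewrite permE; apply/eqP; rewrite -leqn0 leqNgt.
  rewrite -spike_le -phit phi_le spike_le height_of_height.
  by rewrite (negbTE ji).
apply: height_inj => i; rewrite {2}/height tnth_mktuple -/(height x _).
(* Both sides are comparisons with a spike, and [phi] carries one to the other. Taking [k] to be
   each height in turn then gives equality. *)
have key k : (k <= height (phi x) i)%N = (k <= height x (s^-1%g i))%N.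
  by rewrite -!spike_le -[RHS]phi_le phis permKV.
by apply/eqP; rewrite eqn_leq -key leqnn key leqnn.
Qed.

End Automorphism.

(** * Units as total order automorphisms *)

Section Units.
Context {d : Order.disp_t} {T : bLatticeType d}.

Lemma ipf_mulE (f g : ipf T) x : ipf_map (f * g)%g x = obind g (ipf_map f x).
Proof. by []. Qed.

Lemma ipf_oneE (x : T) : ipf_map (1%g : ipf T) x = Some x.
Proof. by []. Qed.

Lemma unit_automorphism (a : units (ipf T)) :
  exists phi psi : T -> T, [/\ cancel phi psi, cancel psi phi,
    {mono phi : x y / x <= y} & forall x, ipf_map (unit_val a) x = Some (phi x)].
Proof.
case: a => a /= /asboolP[b [ab ba]].
(* A composite equal to the identity is defined everywhere, so [f] is total and [g] undoes it on its
   values. *)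
have bijP (f g : ipf T) : (f * g)%g = 1%g ->
    {phi & forall x, ipf_map f x = Some (phi x) /\ ipf_map g (phi x) = Some x}.
  move=> fg; apply: (@choice _ _ (fun x y => f x = Some y /\ g y = Some x)) => x.
  have := ipf_mulE f g x; rewrite fg ipf_oneE => /esym.
  by case: (ipf_map f x) => //= y gy; exists y.
have [phi phiP] := bijP _ _ ab; have [psi psiP] := bijP _ _ ba.
exists phi, psi; split.
- by move=> x; have [] := psiP (phi x); have [_ ->] := phiP x; case.
- by move=> x; have [] := phiP (psi x); have [_ ->] := psiP x; case.
- move=> x y; have [_ [_ [_ _ a_le]]] := ipf_mapP a.
  by apply/idP/idP => /(a_le _ _ _ _ (phiP x).1 (phiP y).1).
- by move=> x; have [] := phiP x.
Qed.

(** Domain and range are the whole order, the principal filter generated by [\bot]. *)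
Lemma filter_iso_automorphism (phi psi : T -> T) :
    cancel phi psi -> cancel psi phi -> {mono phi : x y / x <= y} ->
  filter_iso (fun x => Some (phi x)).
Proof.
move=> phiK psiK phi_le; exists \bot, \bot; rewrite /principal_filter; split.
- by move=> x; rewrite le0x; split=> // _; exists (phi x).
- by move=> y; rewrite le0x; split=> // _; exists (psi y); rewrite psiK.
- by move=> x x' _ _ [<-] [<-]; rewrite phi_le.
Qed.

End Units.

(** * Coordinate permutations and the isomorphism *)

Section PermuteCoords.
Variable n : nat.
Implicit Types (s t : 'S_n) (x y : posnats n).

(** The inverse in [permute_coords] makes this a right action, matching left-to-right products. *)
Lemma permute_coordsM s t x :
  permute_coords (s * t)%g x = permute_coords t (permute_coords s x).
Proof. by apply: eq_from_tnth => i; rewrite !tnth_mktuple invMg permM. Qed.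

Lemma permute_coords1 x : permute_coords 1 x = x.
Proof. by apply: eq_from_tnth => i; rewrite tnth_mktuple invg1 perm1. Qed.

Lemma permute_coordsK s : cancel (permute_coords s) (permute_coords s^-1).
Proof. by move=> x; rewrite -permute_coordsM mulgV permute_coords1. Qed.

Lemma permute_coordsVK s : cancel (permute_coords s^-1) (permute_coords s).
Proof. by move=> x; rewrite -permute_coordsM mulVg permute_coords1. Qed.

Lemma permute_coords_le s : {mono (@permute_coords n s) : x y / x <= y}.
Proof.
have le t x y : x <= y -> permute_coords t x <= permute_coords t y.
  by rewrite !leEtprod => /forallP xy; apply/forallP => i; rewrite !tnth_mktuple.
move=> x y; apply/idP/idP; last exact: le.
by move=> /(le s^-1%g); rewrite !permute_coordsK.
Qed.

Lemma permute_coords_faithful s t : permute_coords s =1 permute_coords t -> s = t.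
Proof.
move=> st; apply: invg_inj; apply/permP => i.
(* [s] sends this atom to the atom at [i]; for [t] to give height 1 at [i] too, [t^-1 i] must equal
   [s^-1 i]. *)
have := congr1 (fun x => height x i) (st (spike (s^-1%g i) 1)).
rewrite /height !tnth_mktuple eqxx.
by case: eqP.
Qed.

Definition permute_coords_ipf s : ipf (posnats n) :=
  Ipf (filter_iso_automorphism (permute_coordsK s) (permute_coordsVK s)
    (permute_coords_le s)).

Lemma permute_coords_ipf_unit s : permute_coords_ipf s \in @is_unit (ipf (posnats n)).
Proof.
apply/asboolP; exists (permute_coords_ipf s^-1).
by split; apply: ipf_ext => x;
  rewrite ipf_mulE ipf_oneE /= ?permute_coordsK ?permute_coordsVK.
Qed.

(** The sigma type lets [unit_perm] be a function; by faithfulness the permutation is unique. *)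
Lemma unit_permute_coords (a : units (ipf (posnats n))) :
  {s : 'S_n | forall x, ipf_map (unit_val a) x = Some (permute_coords s x)}.
Proof.
apply/cid; have [phi [psi [phiK psiK phi_le aE]]] := unit_automorphism a.
have [s sE] := automorphism_permute_coords phiK psiK phi_le.
by exists s => x; rewrite aE sE.
Qed.

Definition unit_perm (a : units (ipf (posnats n))) : 'S_n :=
  sval (unit_permute_coords a).

Lemma unit_permE a x : ipf_map (unit_val a) x = Some (permute_coords (unit_perm a) x).
Proof. exact: (svalP (unit_permute_coords a)). Qed.

(** Both permutations act alike on every point, so faithfulness identifies them. *)
Lemma unit_permM : {morph unit_perm : a b / (a * b)%g}.
Proof.
move=> a b; apply: permute_coords_faithful => x; apply: Some_inj.
rewrite permute_coordsM -!unit_permE valM ipf_mulE.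
by rewrite [ipf_map _ x]unit_permE.
Qed.

HB.instance Definition _ :=
  isMultiplicative.Build (units (ipf (posnats n))) 'S_n unit_perm unit_permM.

Lemma unit_perm_bij : bijective unit_perm.
Proof.
exists (fun s => Unit (permute_coords_ipf_unit s)) => [a|s].
  by apply/val_inj/ipf_ext => x; apply/esym/unit_permE.
by apply: permute_coords_faithful => x; apply: Some_inj; rewrite -unit_permE.
Qed.

End PermuteCoords.

Theorem theorem2p5 (n : nat) (n_gt0 : (0 < n)%N) :
  isomorphic (units (ipf (posnats n))) 'S_n /\
  forall a : units (ipf (posnats n)),
    exists s : 'S_n, forall x : posnats n,
      ipf_map (unit_val a) x = Some (permute_coords s x).
Proof.
split; first by exists (@unit_perm n); exact: unit_perm_bij.
by move=> a; exists (unit_perm a) => x; exact: unit_permE.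
Qed.
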